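(* Let $p \ge 1$ be real and let $n \ge 1$ be an integer. The coefficient of the first term of $\frac{d^n}{dx^n}(\sin_p x)$, namely $(-1)^{n-1}(p-1)_{n-1}$, satisfies $$(-1)^{n-1} (p-1)_{n-1} = (-1)^{n-1} \frac{(p)_{n}}{p} = \frac{(-1)^{n-1}}{p} \sum_{k=1}^n s(n, k)\, p^k.$$
   Context: The falling factorial is $(x)_0 := 1$ and $(x)_n := x(x-1)\cdots(x-n+1)$ for $n\ge 1$. The Stirling numbers of the first kind $s(n,k)$ are defined by $(x)_n = \sum_{k=1}^n s(n,k)x^k$ for $n \ge 1$. Write $[m,n]_p := \cos_p^m(x)\sin_p^n(x)$, where on $[0,\pi_p/2]$, with $\pi_p := 2\int_0^1 (1-s^p)^{-\frac{p-1}{p}}ds$, the functions $\cos_p, \sin_p$ are the nonnegative solution of $\cos_p' = -\sin_p^{p-1}$, $\sin_p' = \cos_p^{p-1}$, $\cos_p 0 = 1$, $\sin_p 0 = 0$ (with $0^0=1$ when $p=1$). Successive derivatives of $\sin_p x$ are computed starting from $\frac{d}{dx}\sin_p x = [p-1,0]_p$ by repeatedly applying the rule $\frac{d}{dx}[m,n]_p=-m[m-1,n+p-1]_p+n[m+p-1,n-1]_p$ termwise. The first term of $\frac{d^n}{dx^n}(\sin_p x)$ is defined recursively: for $n=1$ it is $1\cdot[p-1,0]_p$; if the first term of the $n$th derivative is $c\,[a,b]_p$, then the first term of the $(n+1)$st derivative is the first summand produced by the rule, $-ca\,[a-1,b+p-1]_p$. The coefficient of the term $c\,[a,b]_p$ is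 $c$. *)

(* Defs.v *)
From HB Require Import structures.
From mathcomp Require Import all_boot all_order all_algebra.
From mathcomp Require Import all_classical all_reals all_analysis.
From mathcomp Require Import ring.
Set Implicit Arguments.
Unset Strict Implicit.
Unset Printing Implicit Defensive.
Import Order.TTheory GRing.Theory Num.Theory.
Import numFieldNormedType.Exports.
Local Open Scope classical_set_scope.
Local Open Scope ring_scope.

Definition fallfact (A : nzRingType) (x : A) (n : nat) : A :=
  \prod_(i < n) (x - i%:R).

(* Signed: the coefficient of X^k in X (X - 1) ... (X - n + 1). *)
Definition stirling1 (n k : nat) : int := (fallfact ('X : {poly int}) n)`_k.

Section Pi_p.
Context {R : realType}.

Definition pi_p (p : R) : R :=
  2 * \int[lebesgue_measure]_(s in `[0, 1]) (1 - s `^ p) `^ (- ((p - 1) / p)).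

(* [powR] satisfies 0 `^ 0 = 1, the convention needed when p = 1.  The
   equations are required inside the interval only: given continuity on the
   closed interval, the one-sided equations at the endpoints follow. *)
Record is_cossinp (p : R) (cosp sinp : R -> R) : Prop := IsCosSinp {
  cosp0 : cosp 0 = 1;
  sinp0 : sinp 0 = 0;
  cosp_ge0 : {in `[0, pi_p p / 2], forall x, 0 <= cosp x};
  sinp_ge0 : {in `[0, pi_p p / 2], forall x, 0 <= sinp x};
  cosp_continuous : {within `[0, pi_p p / 2], continuous cosp};
  sinp_continuous : {within `[0, pi_p p / 2], continuous sinp};
  cosp_derive : {in `]0, pi_p p / 2[, forall x : R,
    is_derive x 1 cosp (- (sinp x `^ (p - 1)))};
  sinp_derive : {in `]0, pi_p p / 2[, forall x : R,
    is_derive x 1 sinp (cosp x `^ (p - 1))} }.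

End Pi_p.

(* [Term c a b] is the formal term c [a, b]_p.  Terms are kept formal because
   the coefficient is not determined by the function, and terms with
   coefficient 0 must not be discarded. *)
Record term (R : Type) := Term { coef : R; cos_exp : R; sin_exp : R }.

Section Derivatives.
Context {R : realType}.
Implicit Types (p x : R) (t : term R) (s : seq (term R)).

Definition term_rule1 p t : term R :=
  Term (- coef t * cos_exp t) (cos_exp t - 1) (sin_exp t + p - 1).

Definition term_rule2 p t : term R :=
  Term (coef t * sin_exp t) (cos_exp t + p - 1) (sin_exp t - 1).

Definition derive_terms p s : seq (term R) :=
  flatten [seq [:: term_rule1 p t; term_rule2 p t] | t <- s].

(* The summands of the n-th derivative of sin_p, and the first of them, for
   n >= 1 (the value at n = 0 is irrelevant). *)
Definition sinp_derivative p (n : nat) : seq (term R) :=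
  iter n.-1 (derive_terms p) [:: Term 1 (p - 1) 0].

Definition sinp_first_term p (n : nat) : term R :=
  iter n.-1 (term_rule1 p) (Term 1 (p - 1) 0).

Definition term_eval (cosp sinp : R -> R) t x : R :=
  coef t * (cosp x `^ cos_exp t * sinp x `^ sin_exp t).

Lemma sinp_first_termE p n :
  sinp_first_term p n = head (Term 0 0 0) (sinp_derivative p n).
Proof.
rewrite /sinp_first_term /sinp_derivative.
suff [s ->] : exists s, iter n.-1 (derive_terms p) [:: Term 1 (p - 1) 0] =
  iter n.-1 (term_rule1 p) (Term 1 (p - 1) 0) :: s by [].
elim: n.-1 => [|k [s IH]]; first by exists [::].
by rewrite iterS IH; eexists.
Qed.

Section Soundness.
Variables (p : R) (cosp sinp : R -> R).
Hypothesis H : is_cossinp p cosp sinp.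
Local Notation h := (pi_p p / 2).

Let oc x : x \in `]0, h[ -> x \in `[0, h].
Proof. exact: subset_itv_oo_cc. Qed.

Let sinp_le : {in `[0, h] &, {homo sinp : x y / x <= y}}.
Proof.
apply: ger0_derive1_le_cc (sinp_continuous H).
- by move=> x xh; case: (sinp_derive H xh).
- move=> x xh; rewrite derive1E; have ? := sinp_derive H xh.
  by rewrite derive_val powR_ge0.
Qed.

Let cosp_le : {in `[0, h] &, {homo cosp : x y /~ x <= y}}.
Proof.
apply: ler0_derive1_le_cc (cosp_continuous H).
- by move=> x xh; case: (cosp_derive H xh).
- move=> x xh; rewrite derive1E; have ? := cosp_derive H xh.
  by rewrite derive_val oppr_le0 powR_ge0.
Qed.

Let locally_cst (f : R -> R) (a b c df : R) : a < b ->
  (forall x, x \in `]a, b[ -> f x = c) -> forall x, x \in `]a, b[ ->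
  is_derive x 1 f df -> df = 0.
Proof.
move=> ab fc x xab fx.
have fcst : \near x, cst c x = f x.
  by near=> z; rewrite fc//; near: z; exact: near_in_itvoo.
have := near_eq_is_derive fcst (is_derive_cst c x 1).
by move=> fx'; rewrite -(@derive_val _ _ _ _ _ _ _ fx) derive_val.
Unshelve. all: by end_near. Qed.

Lemma sinp_gt0 : {in `]0, h[, forall x, 0 < sinp x}.
Proof.
move=> x xh; rewrite lt_neqAle (sinp_ge0 H) ?oc// andbT eq_sym.
apply/eqP => sx0.
have /andP[x0 xlt] : (0 < x) && (x < h) by move: xh; rewrite in_itv.
have sub y : y \in `]0, x[ -> y \in `]0, h[.
  by rewrite !in_itv/= => /andP[-> yx]; exact: lt_trans yx xlt.
have s0 y : y \in `]0, x[ -> sinp y = 0.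
  move=> yx; apply/eqP; rewrite eq_le (sinp_ge0 H) ?oc ?sub// andbT -sx0.
  apply: sinp_le; [exact/oc/sub|exact: oc|].
  by move: yx; rewrite in_itv/= => /andP[_ /ltW].
have c0 y : y \in `]0, x[ -> cosp y = 0.
  move=> yx; have := locally_cst x0 s0 yx (sinp_derive H (sub _ yx)).
  by move/eqP; rewrite powR_eq0 => /andP[/eqP].
have zin : 0 \in `[0, h] by rewrite in_itv/= lexx ltW// (lt_trans x0).
have cx : {within `[0, x], continuous cosp}.
  apply: continuous_subspaceW (cosp_continuous H).
  by apply: subset_itvl; rewrite bnd_simp ltW.
have [y yx] := MVT x0 (fun z zx => cosp_derive H (sub z zx)) cx.
have h1 : x / 2 \in `]0, x[ by rewrite in_itv/= divr_gt0//= gtr_pMr// invf_lt1// ltr1n.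
have p1 : p - 1 != 0.
  apply/eqP => p10.
  have := locally_cst x0 s0 h1 (sinp_derive H (sub _ h1)).
  by rewrite p10 powRr0 => /eqP; rewrite oner_eq0.
rewrite s0// powR0// oppr0 mul0r (cosp0 H) => /eqP; rewrite subr_eq0 => /eqP cx1.
have : cosp x <= cosp (x / 2).
  apply: cosp_le; [exact: oc|exact/oc/sub|].
  by move: h1; rewrite in_itv/= => /andP[_ /ltW].
by rewrite cx1 c0// ler10.
Qed.

Lemma cosp_gt0 : {in `]0, h[, forall x, 0 < cosp x}.
Proof.
move=> x xh; rewrite lt_neqAle (cosp_ge0 H) ?oc// andbT eq_sym.
apply/eqP => cx0.
have /andP[x0 xlt] : (0 < x) && (x < h) by move: xh; rewrite in_itv.
have sub y : y \in `]x, h[ -> y \in `]0, h[.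
  by rewrite !in_itv/= => /andP[xy ->]; rewrite (lt_trans x0 xy).
have c0 y : y \in `]x, h[ -> cosp y = 0.
  move=> yx; apply/eqP; rewrite eq_le (cosp_ge0 H) ?oc ?sub// andbT -cx0.
  apply: cosp_le; [exact/oc/sub|exact: oc|].
  by move: yx; rewrite in_itv/= => /andP[/ltW].
have h1 : (x + h) / 2 \in `]x, h[ by rewrite in_itv/= !midf_lt.
have := locally_cst xlt c0 h1 (cosp_derive H (sub _ h1)).
move/eqP; rewrite oppr_eq0 powR_eq0 => /andP[/eqP s0 _].
by have := sinp_gt0 (sub _ h1); rewrite s0 ltxx.
Qed.

Lemma is_derive_term t x : x \in `]0, h[ ->
  is_derive x 1 (term_eval cosp sinp t)
    (term_eval cosp sinp (term_rule1 p t) x +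
     term_eval cosp sinp (term_rule2 p t) x).
Proof.
case: t => c a b xh; rewrite /term_eval /=.
have cgt := cosp_gt0 xh; have sgt := sinp_gt0 xh.
have dc := cosp_derive H xh; have ds := sinp_derive H xh.
have dca : is_derive x 1 (fun z => cosp z `^ a) _ :=
  @is_derive1_comp _ (fun y => y `^ a) cosp x _ _ (is_derive1_powR a cgt) dc.
have dsb : is_derive x 1 (fun z => sinp z `^ b) _ :=
  @is_derive1_comp _ (fun y => y `^ b) sinp x _ _ (is_derive1_powR b sgt) ds.
have -> : (fun z => c * (cosp z `^ a * sinp z `^ b)) =
  c \*: ((fun z => cosp z `^ a) * (fun z => sinp z `^ b)) by [].
apply: is_derive_eq.
rewrite /GRing.scale /=.
rewrite -!(addrA _ p) !(@powRD _ _ _ (p - 1)).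
- by ring.
- by rewrite (gt_eqF cgt) implybT.
- by rewrite (gt_eqF sgt) implybT.
Qed.

Lemma sinp_derivativeE n x : (0 < n)%N -> x \in `]0, h[ ->
  (sinp^`(n))%classic x = \sum_(t <- sinp_derivative p n) term_eval cosp sinp t x.
Proof.
case: n => // n _; rewrite /sinp_derivative /=.
elim: n x => [x xh|n IH x xh].
  have ? := sinp_derive H xh.
  by rewrite big_seq1 /term_eval/= powRr0 mulr1 mul1r derive1E derive_val.
rewrite derive1nS derive1E iterS.
set s := iter n _ _ in IH *.
have -> : 'D_1 (sinp^`(n.+1))%classic x =
    'D_1 (fun z => \sum_(t <- s) term_eval cosp sinp t z) x.
  apply: near_eq_derive; near=> z; apply: IH.
  by near: z; exact: near_in_itvoo.
rewrite /derive_terms big_flatten big_map.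
apply: derive_val.
elim: s {IH} => [|t s IHs].
  rewrite big_nil; under eq_fun do rewrite big_nil.
  exact: is_derive_cst.
rewrite big_cons; under eq_fun do rewrite big_cons.
rewrite big_cons big_seq1.
by apply: is_deriveD IHs; exact: is_derive_term.
Unshelve. all: by end_near. Qed.

End Soundness.
End Derivatives.

(* Main.v *)
Require Import Defs.
From mathcomp Require Import all_boot all_order all_algebra.
From mathcomp Require Import all_classical all_reals all_analysis.
From mathcomp Require Import ring.
Import Order.TTheory GRing.Theory Num.Theory.
Local Open Scope ring_scope.

(** Along the chain of first terms the cosine exponent drops by one at each
differentiation, running through [p - 1], [p - 2], ..., and each step
multiplies the coefficient by minus the current exponent; the coefficient is
therefore a signed falling factorial of [p - 1] ([first_term_iter]).  The
second form comes from [(x)_(n+1) = x (x - 1)_n] ([fallfact_recl]) after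
cancelling [p], which is nonzero since [1 <= p].  The third form evaluates at
[p] the polynomial [(X)_n] over the integers, whose coefficients are by
definition the Stirling numbers ([fallfact_stirling1]); since [X] divides
[(X)_n] for [n >= 1], its constant term vanishes and the sum starts at 1. *)

Lemma fallfact0 (A : nzRingType) (x : A) : fallfact x 0 = 1.
Proof. by rewrite /fallfact big_ord0. Qed.

Lemma fallfact_recr (A : nzRingType) (x : A) (n : nat) :
  fallfact x n.+1 = fallfact x n * (x - n%:R).
Proof. by rewrite /fallfact big_ord_recr. Qed.

Lemma fallfact_recl (A : nzRingType) (x : A) (n : nat) :
  fallfact x n.+1 = x * fallfact (x - 1) n.
Proof.
rewrite /fallfact big_ord_recl subr0; congr (_ * _).
by apply: eq_bigr => i _; rewrite /= /bump leq0n natrD opprD addrA.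
Qed.

(** The exponents are part of the statement because the next coefficient
depends on the current cosine exponent. *)
Lemma first_term_iter (R : realType) (p : R) (k : nat) :
  iter k (term_rule1 p) (Term 1 (p - 1) 0) =
  Term ((-1) ^+ k * fallfact (p - 1) k) (p - 1 - k%:R) (k%:R * (p - 1)).
Proof.
elim: k => [|k IH]; first by rewrite /= fallfact0 mulr1 subr0 mul0r.
rewrite iterS IH /term_rule1 /= fallfact_recr exprS -[k.+1]addn1 natrD.
by congr Term; ring.
Qed.

Lemma size_fallfactX (A : nzRingType) (n : nat) :
  size (fallfact ('X : {poly A}) n) = n.+1.
Proof.
rewrite /fallfact (eq_bigr (fun i : 'I_n => 'X - (i%:R)%:P)); last first.
  by move=> i _; rewrite polyC_natr.
by rewrite size_prod_XsubC /index_enum -enumT size_enum_ord.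
Qed.

(** Falling factorials commute with the base change from the integers and
with evaluation, so that [(x)_n] is the value at [x] of [(X)_n]. *)
Lemma horner_fallfactX (A : comNzRingType) (x : A) (n : nat) :
  (map_poly intr (fallfact ('X : {poly int}) n)).[x] = fallfact x n.
Proof.
rewrite /fallfact rmorph_prod horner_prod; apply: eq_bigr => i _.
by rewrite rmorphB /= map_polyX rmorph_nat -polyC_natr hornerXsubC.
Qed.

Lemma stirling1_S0 (n : nat) : stirling1 n.+1 0 = 0.
Proof. by rewrite /stirling1 fallfact_recl coefXM. Qed.

Lemma fallfact_stirling1 (A : comNzRingType) (x : A) (n : nat) :
  fallfact x n = \sum_(0 <= k < n.+1) (stirling1 n k)%:~R * x ^+ k.
Proof.
rewrite -horner_fallfactX (@horner_coef_wide _ n.+1); last first.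
  by apply: leq_trans (size_poly _ _) _; rewrite size_fallfactX.
by rewrite big_mkord; apply: eq_bigr => i _; rewrite coef_map.
Qed.

Theorem mainTheorem4 (R : realType) (p : R) (n : nat)
    (hp : 1 <= p) (hn : (1 <= n)%N) :
  [/\ coef (sinp_first_term p n) = (-1) ^+ n.-1 * fallfact (p - 1) n.-1,
      (-1) ^+ n.-1 * fallfact (p - 1) n.-1 =
        (-1) ^+ n.-1 * (fallfact p n / p) &
      (-1) ^+ n.-1 * (fallfact p n / p) =
        (-1) ^+ n.-1 / p *
          \sum_(1 <= k < n.+1) (stirling1 n k)%:~R * p ^+ k].
Proof.
have p0 : p != 0 by rewrite gt_eqF // (lt_le_trans ltr01).
case: n hn => // n _; split.
- by rewrite /sinp_first_term first_term_iter.
- by rewrite fallfact_recl mulrAC divff // mul1r.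
- rewrite fallfact_stirling1 big_ltn // stirling1_S0 mul0r add0r.
  by rewrite -[RHS]mulrA [in RHS](mulrC p^-1).
Qed.
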